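(* Let $G$ be a countably infinite group, let $\mathcal{A}$ be a finite alphabet, let $\mathcal{F}\subseteq\mathcal{A}^+_G$ be a set of patterns, and let $\beta$ be a positive real number such that $$|\mathcal{A}|-\sum_{f\in\mathcal{F}}|f|\beta^{1-|f|}>\beta.$$ Then there exists a strongly aperiodic subshift $X\subseteq\mathcal{A}^G$ avoiding $\mathcal{F}$ (that is, every configuration of $X$ avoids every pattern of $\mathcal{F}$). Moreover, if $G$ is amenable, then there exists a strongly aperiodic subshift $X\subseteq\mathcal{A}^G$ avoiding $\mathcal{F}$ and such that $\alpha(X)\ge\beta$.
   Context: A pattern over $G$ is an element $p\in\mathcal{A}^S$ where $S\subseteq G$ is a non-empty finite set, called its support $\operatorname{supp}(p)$; its size is $|p|=|S|$; $\mathcal{A}^+_G$ is the set of all patterns. A configuration is an element $x\in\mathcal{A}^G$. A pattern $f$ appears in a configuration $x$ if there is $g\in G$ with $x(gs)=f(s)$ for all $s\in\operatorname{supp}(f)$; otherwise $x$ avoids $f$. A subshift is a set $X\subseteq\mathcal{A}^G$ of the form $X=\{x\in\mathcal{A}^G: x\text{ avoids every } f\in\mathcal{F}'\}$ for some set of patterns $\mathcal{F}'$. The growth of a subshift $X$ is $\alpha(X)=\lim_{n\to\infty}\big(\min_{S\subseteq G,|S|=n}|\mathcal{G}^{(S)}|\big)^{1/n}$, where $\mathcal{G}^{(S)}$ is the set of $p\in\mathcal{A}^S$ that appear in some $x\in X$. A configuration $x$ has period $g\in G$ if $x(y)=x(gy)$ for all $y\in G$; it is strongly aperiodic if its only period is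 the identity $1_G$; a subshift is strongly aperiodic if all its configurations are strongly aperiodic.
   Formalization: For β<1 it is additionally assumed that at least two letters are not forbidden by one-cell patterns of F; otherwise the claim fails (G=ℤ, |A|=1, F empty, β=1/2). The subshift X is also required to be nonempty. *)

(* Defs.v *)
From HB Require Import structures.
From mathcomp Require Import all_boot all_order all_algebra finmap.
From mathcomp Require Import all_classical all_reals all_analysis.

Set Implicit Arguments.
Unset Strict Implicit.
Unset Printing Implicit Defensive.

Import Order.TTheory GRing.Theory Num.Theory.
Import numFieldNormedType.Exports.

Local Open Scope classical_set_scope.
Local Open Scope ring_scope.

Definition pattern (G : groupType) (A : finType) : Type :=
  {p : {fmap G -> A} | domf p != fset0}.
HB.instance Definition _ (G : groupType) (A : finType) :=
  Choice.on (pattern G A).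

Definition psize (G : groupType) (A : finType) (f : pattern G A) : nat :=
  #|` domf (val f)|.

Definition appears (G : groupType) (A : finType)
    (p : {fmap G -> A}) (x : G -> A) : Prop :=
  exists g : G, forall s : domf p, x (g * val s)%g = p s.

Definition avoids (G : groupType) (A : finType)
    (F : set (pattern G A)) (x : G -> A) : Prop :=
  forall f, F f -> ~ appears (val f) x.

Definition subshift (G : groupType) (A : finType) (X : set (G -> A)) : Prop :=
  exists F : set (pattern G A), X = [set x | avoids F x].

Definition has_period (G : groupType) (A : finType) (x : G -> A) (g : G) :
  Prop := forall y : G, x y = x (g * y)%g.

Definition strongly_aperiodic (G : groupType) (A : finType) (x : G -> A) :
  Prop := forall g : G, has_period x g -> g = 1%g.

Definition strongly_aperiodic_subshift (G : groupType) (A : finType)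
    (X : set (G -> A)) : Prop :=
  subshift X /\ (forall x, X x -> strongly_aperiodic x).

Definition language (G : groupType) (A : finType) (X : set (G -> A))
    (S : {fset G}) : {set {ffun S -> A}} :=
  [set p : {ffun S -> A} | `[< exists2 x, X x & appears (FinMap p) x >]]%SET.

(* The infimum is over a set of naturals, nonempty since G is infinite in all
   uses, hence is a minimum. *)
Definition complexity (R : realType) (G : groupType) (A : finType)
    (X : set (G -> A)) (n : nat) : R :=
  inf [set #|language X S|%:R | S in [set S : {fset G} | #|` S| = n]].

(* [complexity X] is submultiplicative when X is a subshift over an infinite
   group (take translates with disjoint supports), so the limit exists by
   Fekete's lemma. *)
Definition growth (R : realType) (G : groupType) (A : finType)
    (X : set (G -> A)) : R :=
  lim (complexity R X n `^ n%:R^-1 @[n --> \oo]).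

(* Existence of a (left) Folner sequence; G is countable in all uses. *)
Definition amenable (R : realType) (G : groupType) : Prop :=
  exists E : nat -> {fset G}, (forall n, E n != fset0) /\
    forall g : G,
      let gE n := [fset (g * h)%g | h in E n]%fset in
      (#|` ((gE n `\` E n) `|` (E n `\` gE n))%fset|%:R / #|` E n|%:R : R)
        @[n --> \oo] --> (0 : R).

Definition free_letter (G : groupType) (A : finType) (F : set (pattern G A))
    (a : A) : Prop :=
  forall f, F f -> psize f = 1%N -> forall s : domf (val f), val f s != a.

(* Necessary for a nonempty strongly aperiodic subshift avoiding F: with at
   most one free letter, every configuration avoiding F is constant. The bound
   #|A| - \sum_f |f| beta^(1 - |f|) > beta entails it when 1 <= beta, but not
   when beta < 1: take #|A| = 1 and F empty. *)
Definition two_free_letters (G : groupType) (A : finType)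
    (F : set (pattern G A)) : Prop :=
  exists a b : A, [/\ a != b, free_letter F a & free_letter F b].

(* Main.v *)
(* Rosenfeld's counting argument. Besides the patterns of [F], forbid for each
   [g != 1] all configurations that agree on [h T_g] and [h g T_g] for some [h],
   where [T_g] is a large finite set disjoint from [g T_g]; this kills the
   period [g]. Let L(S) be the set of colourings of a finite set S with no
   forbidden event inside S. By induction |L(S + s)| >= beta |L(S)|: an
   extension of a colouring in L(S) that is not in L(S + s) exhibits an event
   at s, and for a period it is determined by its restriction to the complement
   of either half [h T_g], [h g T_g] of the event, so that a period costs only
   2 |T_g| beta^(1-|T_g|), which is as small as we like once beta > 1.
   Since L(O) embeds into (restrictions of L(O) to S) x L(O - S), and
   beta^|S| |L(O - S)| <= |L(O)|, at least beta^|S| colourings of S extend to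
   L(O) for every finite O, hence by compactness to configurations of the
   subshift. *)
Require Import Defs.
From HB Require Import structures.
From mathcomp Require Import all_boot all_order all_algebra finmap.
From mathcomp Require Import all_classical all_reals all_analysis.
From mathcomp Require Import lra zify.

Set Implicit Arguments.
Unset Strict Implicit.
Unset Printing Implicit Defensive.

Import Order.TTheory GRing.Theory Num.Theory.
Import numFieldNormedType.Exports.

Local Open Scope ring_scope.

(** * Counting good colourings of a finite set of cells *)

Section FiniteCounting.
Variables (R : realFieldType) (V A : finType) (J : eqType) (D : set J).
Variables (W : J -> {set V}) (bad : J -> {set {ffun V -> A}}).
Variables (U : J -> V -> {set V}) (B : {set A}) (a0 : A) (beta : R).
Hypothesis beta_gt0 : 0 < beta.
Hypothesis bad_local : forall j (x y : {ffun V -> A}),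
  D j -> {in W j, x =1 y} -> x \in bad j -> y \in bad j.
Hypothesis mem_erased : forall j s, D j -> s \in W j -> s \in U j s.
Hypothesis erased_sub : forall j s, D j -> s \in W j -> U j s \subset W j.
(** The cells of [U j s] are redundant in the event [j]: their colours can be recovered from the
    other cells. The more cells can be erased, the smaller the cost of [j] when [beta] exceeds [1].
    The cost is bounded over finite lists because [J] may be infinite. *)
Hypothesis bad_determined : forall j s (x y : {ffun V -> A}),
  D j -> s \in W j -> x \in bad j -> y \in bad j ->
  {in ~: U j s, x =1 y} -> x = y.
Hypothesis cost : forall s (l : seq J), uniq l ->
  (forall j, j \in l -> D j /\ s \in W j) ->
  \sum_(j <- l) beta ^- (#|U j s|.-1) <= #|B|%:R - beta.

(** The value [a0] off [S] normalises colourings, so that those of different sets [S] live in one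
    finite type and are counted without repetition. *)
Definition good (S : {set V}) : {set {ffun V -> A}} :=
  [set x : {ffun V -> A} | `[< [/\ {in S, forall v, x v \in B},
    {in ~: S, forall v, x v = a0} & forall j, D j -> W j \subset S -> x \notin bad j] >]]%SET.

Lemma goodP (S : {set V}) (x : {ffun V -> A}) :
  reflect [/\ {in S, forall v, x v \in B}, {in ~: S, forall v, x v = a0}
    & forall j, D j -> W j \subset S -> x \notin bad j] (x \in good S).
Proof. by rewrite inE; apply: asboolP. Qed.

Definition restr (S : {set V}) (x : {ffun V -> A}) : {ffun V -> A} :=
  [ffun v => if v \in S then x v else a0].

Lemma restr_good (S T : {set V}) (x : {ffun V -> A}) :
  T \subset S -> x \in good S -> restr T x \in good T.
Proof.
move=> TS /goodP[xB xa xbad]; apply/goodP; split.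
- by move=> v vT; rewrite ffunE vT xB// (fintype.subsetP TS).
- by move=> v; rewrite inE ffunE => /negbTE ->.
- move=> j Dj WT; apply: contra (xbad j Dj (fintype.subset_trans WT TS)).
  by apply: bad_local => // v vW; rewrite ffunE (fintype.subsetP WT).
Qed.

(** The cells of [T] are put back one at a time. The one-cell inequality is assumed only below [S],
    which is what the strong induction of [good_extend] supplies. *)
Lemma good_setD_below (S T : {set V}) :
  (forall (S' : {set V}) s, S' \proper S -> s \notin S' ->
     beta * #|good S'|%:R <= #|good (s |: S')|%:R) ->
  T \subset S -> beta ^+ #|T| * #|good (S :\: T)|%:R <= #|good S|%:R.
Proof.
move=> step; have [n] := ubnP #|T|; elim: n T => // n IHn T Tn TS.
have [->|/finset.set0Pn[s sT]] := eqVneq T finset.set0.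
  by rewrite cards0 mul1r finset.setD0.
have sS : s \in S by apply: (fintype.subsetP TS).
have := IHn (T :\ s) _ _; rewrite (cardsD1 s T) sT add1n exprSr -mulrA.
move=> IH; apply: le_trans (IH _ _); last 2 first.
- by move: Tn; rewrite (cardsD1 s T) sT.
- by rewrite (fintype.subset_trans _ TS)// finset.subD1set.
have -> : S :\: (T :\ s) = s |: (S :\: T).
  apply/setP => v; rewrite !inE.
  by case: eqVneq => //= ->.
rewrite ler_pM2l ?exprn_gt0//; apply: step; last by rewrite !inE sT.
apply/fintype.properP; split; first exact: finset.subsetDl.
by exists s; rewrite ?inE ?sT.
Qed.

(* Every bad one-point extension [x] of a good colouring violates some [j]
   whose window contains [s]; erasing [x] on [U j s] is injective and lands in
   [good (S :\: U j s)], which is smaller than [good S] by a factor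
   [beta ^- (#|U j s|.-1)] by induction. *)
Lemma good_extend (S : {set V}) s : s \notin S ->
  beta * #|good S|%:R <= #|good (s |: S)|%:R.
Proof.
have [n] := ubnP #|S|; elim: n S s => // n IHn S s Sn sS.
have below (T : {set V}) : T \subset S ->
    beta ^+ #|T| * #|good (S :\: T)|%:R <= #|good S|%:R.
  apply: good_setD_below => S' s' S'S s'S'; apply: IHn => //.
  exact: leq_trans (proper_card S'S) Sn.
pose upd (yb : {ffun V -> A} * A) : {ffun V -> A} :=
  [ffun v => if v == s then yb.2 else yb.1 v].
pose Ext := [set upd yb | yb in finset.setX (good S) B].
have cardExt : #|Ext| = (#|good S| * #|B|)%N.
  rewrite card_in_imset ?cardsX// => -[y b] [y' b'].
  rewrite !finset.in_setX /= => /andP[/goodP[_ ya _] _] /andP[/goodP[_ ya' _] _].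
  move=> /ffunP eq; congr pair; last by have := eq s; rewrite !ffunE eqxx.
  apply/ffunP => v; have := eq v; rewrite !ffunE.
  by case: eqVneq => // -> _; rewrite ya ?ya'// inE.
have ExtS x : x \in Ext -> [/\ {in s |: S, forall v, x v \in B},
    {in ~: (s |: S), forall v, x v = a0} &
    forall j, D j -> W j \subset S -> x \notin bad j].
  move=> /imsetP[[y b]]; rewrite finset.in_setX /= => /andP[/goodP[yB ya ybad] bB] ->.
  split.
  - move=> v; rewrite !inE ffunE /=; case: eqVneq => //= _; exact: yB.
  - move=> v; rewrite !inE ffunE /= negb_or => /andP[/negbTE -> vS].
    by apply: ya; rewrite inE.
  - move=> j Dj WS; apply: contra (ybad j Dj WS); apply: bad_local => // v vW.
    rewrite ffunE /=; case: eqVneq => // vs.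
    by move: sS; rewrite -vs (fintype.subsetP WS).
pose Bad := Ext :\: good (s |: S).
(* One violated event is selected for each bad extension; [None] is a dummy value outside [Bad]. *)
have /choice[w wP] : forall x, exists wx : option J, x \in Bad ->
    exists2 j, wx = Some j & [/\ D j, s \in W j, W j \subset s |: S & x \in bad j].
  move=> x; have [|] := boolP (x \in Bad); last by exists None.
  rewrite inE => /andP[xng /ExtS[xB xa xbad]].
  suff [j [Dj Wj xj]] : exists j, [/\ D j, W j \subset s |: S & x \in bad j].
    exists (Some j) => _; exists j => //; split => //.
    (* A window avoiding [s] would lie inside [S], where the extension still agrees with a good
       colouring. *)
    apply: contraPT xj => sW; apply/negP; apply: xbad => //.
    apply/fintype.subsetP => v vW; have := fintype.subsetP Wj v vW.
    rewrite !inE => /orP[/eqP vs|//].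
    by move: sW; rewrite -vs vW.
  apply: contrapT => nex; move/goodP : xng; apply; split => // j Dj Wj.
  by apply/negP => xj; apply: nex; exists j.
pose l := undup (pmap w (enum Bad)).
have lP j : j \in l -> [/\ D j, s \in W j & W j \subset s |: S].
  rewrite mem_undup mem_pmap => /mapP[x]; rewrite mem_enum => /wP[j' -> [? ? ? ?]].
  by case=> ->.
have Badl : #|Bad|%:R <= \sum_(j <- l) (#|Ext :&: bad j|%:R : R).
  rewrite -natr_sum ler_nat.
  have : Bad \subset \bigcup_(j <- l) (Ext :&: bad j)%SET.
    apply/fintype.subsetP => x xBad; have [j wj [Dj sW Wj xj]] := wP x xBad.
    have jl : j \in l.
      rewrite mem_undup mem_pmap; apply/mapP; exists x; rewrite ?mem_enum//.
    rewrite (big_rem j jl) /= !inE xj andbT; apply/orP; left.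
    by move: xBad; rewrite inE => /andP[].
  move=> /subset_leq_card /leq_trans; apply.
  elim: (l) => [|j l' IH]; first by rewrite !big_nil cards0.
  rewrite !big_cons; apply: leq_trans (leq_card_setU _ _) _.
  by rewrite leq_add2l.
have badj j : j \in l -> #|Ext :&: bad j|%:R <= beta ^- (#|U j s|.-1) * #|good S|%:R.
  move=> /lP[Dj sW Wj].
  have sU := mem_erased Dj sW; have UW := erased_sub Dj sW.
  have cardU : #|U j s :\ s| = #|U j s|.-1 by rewrite (cardsD1 s (U j s)) sU.
  have := below (U j s :\ s).
  have -> : S :\: (U j s :\ s) = S :\: U j s.
    apply/setP => v; rewrite !inE; case: eqVneq => //= ->.
    by rewrite sU (negbTE sS).
  rewrite cardU => /(_ _) le; rewrite mulrC ler_pdivlMr ?exprn_gt0// mulrC.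
  apply: le_trans (le _); last first.
    apply/fintype.subsetP => v; rewrite !inE => /andP[vs vU].
    by have := fintype.subsetP Wj v (fintype.subsetP UW v vU); rewrite !inE (negbTE vs).
  rewrite ler_pM2l ?exprn_gt0// ler_nat.
  rewrite -(@card_in_imset _ _ (restr (S :\: U j s)) (Ext :&: bad j)%SET).
    apply: subset_leq_card; apply/fintype.subsetP => z /imsetP[x + ->].
    rewrite inE => /andP[/ExtS[xB xa xbad] _]; apply/goodP; split.
    - move=> v; rewrite ffunE => vS; rewrite vS xB//.
      by move: vS; rewrite !inE => /andP[_ ->]; rewrite orbT.
    - by move=> v; rewrite inE ffunE => /negbTE ->.
    - move=> j' Dj' Wj'.
      have WS : W j' \subset S by rewrite (fintype.subset_trans Wj')// finset.subsetDl.
      apply: contra (xbad j' Dj' WS).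
      by apply: bad_local => // v vW; rewrite ffunE (fintype.subsetP Wj').
  move=> x y; rewrite !inE => /andP[/ExtS[_ xa _] xj] /andP[/ExtS[_ ya _] yj] /ffunP eq.
  apply: (bad_determined Dj sW xj yj) => v; rewrite inE => vU.
  have := eq v; rewrite !ffunE !inE vU /=; case: ifPn => // vS _.
  have vs : v != s by apply: contraNneq vU => ->.
  by rewrite xa ?ya// !inE negb_or vs.
have BadS : #|Bad|%:R <= (#|B|%:R - beta) * #|good S|%:R.
  apply: le_trans Badl _; apply: le_trans (_ : \sum_(j <- l)
     beta ^- (#|U j s|.-1) * #|good S|%:R <= _).
    by rewrite big_seq [leRHS]big_seq; apply: ler_sum => j /badj.
  rewrite -mulr_suml ler_wpM2r// cost ?undup_uniq// => j /lP[Dj sW _]; by split.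
(* Of the [#|good S| * #|B|] extensions, at most [(#|B| - beta) * #|good S|] are bad, so at least
   [beta * #|good S|] remain. *)
have : (#|Ext| <= #|Bad| + #|good (s |: S)|)%N.
  rewrite -(cardsID (good (s |: S)) Ext) addnC leq_add2l.
  exact/subset_leq_card/finset.subsetIr.
rewrite -(ler_nat R) cardExt natrD natrM; move: BadS.
rewrite mulrBl [_ * #|B|%:R]mulrC; lra.
Qed.

Lemma good_setD (S T : {set V}) : T \subset S ->
  beta ^+ #|T| * #|good (S :\: T)|%:R <= #|good S|%:R.
Proof. by apply: good_setD_below => S' s _; apply: good_extend. Qed.

Hypothesis window_neq0 : forall j, D j -> W j != finset.set0.

Lemma card_restr_good (S T : {set V}) : T \subset S ->
  beta ^+ #|T| <= #|[set restr T x | x in good S]|%:R.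
Proof.
(* This factor will be cancelled. It is positive because the constant colouring [a0] is good on the
   empty set, no window being empty. *)
move=> TS; have good_gt0 : (0 : R) < #|good (S :\: T)|%:R.
  have good0 : [ffun => a0] \in good finset.set0.
    apply/goodP; split => [v|v _|j Dj]; rewrite ?inE ?ffunE// finset.subset0.
    by rewrite (negbTE (window_neq0 Dj)).
  have := @good_setD (S :\: T) (S :\: T) (subxx _).
  rewrite finset.setDv; apply: lt_le_trans.
  rewrite mulr_gt0 ?exprn_gt0// ltr0n card_gt0; apply/finset.set0Pn.
  by exists [ffun => a0].
rewrite -(ler_pM2r good_gt0); apply: le_trans (good_setD TS) _.
rewrite -natrM ler_nat -cardsX.
pose f x := (restr T x, restr (S :\: T) x).
rewrite -(@card_in_imset _ _ f (good S)).
  apply: subset_leq_card; apply/fintype.subsetP => z /imsetP[x xS ->].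
  by rewrite finset.in_setX /= imset_f// (restr_good _ xS)// finset.subsetDl.
move=> x y /goodP[_ xa _] /goodP[_ ya _] [/ffunP eqT /ffunP eqS].
apply/ffunP => v; have := eqT v; have := eqS v; rewrite !ffunE !inE.
case: (v \in T) => //= ; case: ifPn => // vS _ _.
by rewrite xa ?ya// inE.
Qed.

End FiniteCounting.

(** * Compactness of the space of configurations *)

(* Pick [xi S] in [Y S] for each [S]; the limit of [xi] along an ultrafilter
   containing all the sets [{T | S `<=` T}] is in every [Y S]. *)
Lemma finitary_compactness (G : choiceType) (A : finType)
    (Y : {fset G} -> set (G -> A)) :
  (forall (S T : {fset G}) x y, (S `<=` T)%fset -> Y T x ->
     {in S, x =1 y} -> Y S y) ->
  (forall S, (Y S !=set0)%classic) -> exists x, forall S, Y S x.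
Proof.
move=> Y_local /choice[xi Yxi].
pose F : set_system {fset G} :=
  [set P | exists S, forall T, (S `<=` T)%fset -> P T]%classic.
have FF : ProperFilter F.
  apply: Build_ProperFilter_ex; first by move=> P [S SP]; exists S; apply: SP.
  split.
  - by exists fset0.
  - move=> P Q [S SP] [T TQ]; exists (S `|` T)%fset => Z STZ.
    split; [apply: SP|apply: TQ]; apply: fsubset_trans STZ;
      [exact: fsubsetUl|exact: fsubsetUr].
  - by move=> P Q PQ [S SP]; exists S => T /SP /PQ.
have [L [UL FL]] := ultraFilterLemma FF.
(* Since [A] is finite, the ultrafilter contains the set of those [S] at which [xi S g] takes some
   fixed colour; this colour is the limit at [g]. *)
have /choice[x xP] g : exists a, L [set S | xi S g = a]%classic.
  apply: contrapT => nex.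
  have : \forall S \near L, forall a, xi S g <> a.
    apply: filter_forall => a.
    have [La|//] := in_ultra_setVsetC [set S | xi S g = a]%classic UL.
    by exfalso; apply: nex; exists a.
  by move=> /filter_ex[S /(_ (xi S g))].
exists x => S.
have : \forall T \near L, (S `<=` T)%fset /\ {in S, xi T =1 x}.
  apply: filterI; first by apply: FL; exists S.
  have /filterS : L (\bigcap_(g in [set` S]) [set T | xi T g = x g])%classic.
    by apply: filter_bigI => g _; exact: xP.
  by apply => T xiT g gS; apply: xiT.
by move=> /filter_ex[T [ST xiT]]; exact: Y_local ST (Yxi T) xiT.
Qed.

Lemma ler_sum_subset (R : numDomainType) (T : eqType) (f : T -> R) (s t : seq T) :
  (forall x, 0 <= f x) -> uniq s -> {subset s <= t} ->
  \sum_(x <- s) f x <= \sum_(x <- t) f x.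
Proof.
move=> f0; elim: s t => [|a s IHs] t /=.
  by move=> _ _; rewrite big_nil sumr_ge0.
move=> /andP[as_ us] st; have a_t : a \in t by rewrite st ?mem_head.
rewrite big_cons (big_rem a a_t) lerD2l IHs// => x xs.
have := st x; rewrite inE xs orbT => /(_ isT).
rewrite (perm_mem (perm_to_rem a_t)) inE => /orP[/eqP xa|//].
by rewrite -xa xs in as_.
Qed.

(** * Translation-invariant constraints on a group *)

Section GroupCounting.
Variables (R : realFieldType) (G : groupType) (A : finType) (I : choiceType).
Variables (D : set I) (W : I -> {fset G}) (P : I -> set (G -> A)).
Variables (U : I -> G -> {fset G}) (B : {set A}) (beta : R).
Hypothesis beta_gt0 : 0 < beta.
Hypothesis P_local : forall i (x y : G -> A),
  D i -> {in W i, x =1 y} -> P i x -> P i y.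
Hypothesis mem_U : forall i t, D i -> t \in W i -> t \in U i t.
Hypothesis U_sub : forall i t, D i -> t \in W i -> (U i t `<=` W i)%fset.
Hypothesis P_determined : forall i t (x y : G -> A),
  D i -> t \in W i -> P i x -> P i y ->
  {in (W i `\` U i t)%fset, x =1 y} -> {in W i, x =1 y}.
Hypothesis W_neq0 : forall i, D i -> W i != fset0.
(** A translate of [W i] through a given cell is determined by the position [t] of that cell in the
    window, so the inner sum runs over all such translates. *)
Hypothesis cost : forall l : seq I, uniq l -> (forall i, i \in l -> D i) ->
  \sum_(i <- l) \sum_(t <- W i) beta ^- (#|` U i t|.-1) <= #|B|%:R - beta.

Definition constrained : set (G -> A) :=
  [set x | (forall g, x g \in B) /\
    forall i h, D i -> ~ P i (fun t => x (h * t)%g)]%classic.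

Definition locally_constrained (O : {fset G}) : set (G -> A) :=
  [set x | {in O, forall g, x g \in B} /\
    forall i h, D i -> {in W i, forall t, (h * t)%g \in O} ->
      ~ P i (fun t => x (h * t)%g)]%classic.

Lemma locally_constrained_sub (S T : {fset G}) x y :
  (S `<=` T)%fset -> locally_constrained T x -> {in S, x =1 y} ->
  locally_constrained S y.
Proof.
move=> /fsubsetP ST [xB xP] xy; split => [g gS|i h Di WS Py].
  by rewrite -xy// xB// ST.
apply: (xP i h Di) => [t /WS /ST//|].
by apply: P_local Py => // t /WS tS; rewrite xy.
Qed.

(** This is the finite count with [O] as the set of cells and, as events, the pairs [(i, h)] for
    which [h * W i] lies in [O]. *)
Lemma card_locally_constrained (S O : {fset G}) : (S `<=` O)%fset ->
  beta ^+ #|` S| <= #|[set p : {ffun S -> A} | `[< exists2 x,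
    locally_constrained O x & forall s : S, x (val s) = p s >]]%SET|%:R.
Proof.
move=> SO.
(* The cost bound for the empty list gives [beta <= #|B|], so there is a letter to use as
   default. *)
have /card_gt0P[a0 _] : (0 < #|B|)%N.
  rewrite -(ltr_nat R); apply: lt_le_trans beta_gt0 _.
  by have := @cost [::] isT (fun _ => ltac:(done)); rewrite big_nil subr_ge0.
pose ext (x : {ffun O -> A}) g := if insub g is Some v then x v else a0.
have extE (x : {ffun O -> A}) (v : O) : ext x (val v) = x v.
  by rewrite /ext valK.
pose D' : set (I * G) :=
  [set j | D j.1 /\ {in W j.1, forall t, (j.2 * t)%g \in O}]%classic.
pose W' (j : I * G) : {set O} := [set v : O | (j.2^-1 * val v)%g \in W j.1]%SET.
pose bad (j : I * G) : {set {ffun O -> A}} :=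
  [set x : {ffun O -> A} | `[< P j.1 (fun t => ext x (j.2 * t)%g) >]]%SET.
pose U' (j : I * G) (s : O) : {set O} :=
  [set v : O | (j.2^-1 * val v)%g \in U j.1 (j.2^-1 * val s)%g]%SET.
have liftO (j : I * G) t : D' j -> t \in W j.1 ->
    exists2 v : O, val v = (j.2 * t)%g & (j.2^-1 * val v)%g = t.
  by move=> [_ jO] /jO tO; exists [` tO]%fset; rewrite //= mulKg.
have badE x j : (x \in bad j) = P j.1 (fun t => ext x (j.2 * t)%g) :> Prop.
  by rewrite inE asboolE.
have bad_local j (x y : {ffun O -> A}) :
    D' j -> {in W' j, x =1 y} -> x \in bad j -> y \in bad j.
  move=> D'j xy; rewrite !badE => Px.
  apply: (@P_local j.1 _ _ _ _ Px) => [|t tW]; first by case: D'j.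
  have [v v1 v2] := liftO j t D'j tW.
  by rewrite -v1 !extE; apply: xy; rewrite inE v2.
have mem_U' j s : D' j -> s \in W' j -> s \in U' j s.
  by move=> [Dj _]; rewrite !inE => /mem_U; apply.
have U'_sub j s : D' j -> s \in W' j -> U' j s \subset W' j.
  move=> [Dj _]; rewrite inE => sW; apply/fintype.subsetP => v; rewrite !inE.
  exact/fsubsetP/U_sub.
have determined j s (x y : {ffun O -> A}) : D' j -> s \in W' j ->
    x \in bad j -> y \in bad j -> {in ~: U' j s, x =1 y} -> x = y.
  move=> D'j; rewrite !badE inE => sW Px Py xy.
  have Dj : D j.1 by case: D'j.
  apply/ffunP => v; have [vU|vU] := boolP (v \in U' j s); last first.
    by apply: xy; rewrite inE.
  have vW : (j.2^-1 * val v)%g \in W j.1.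
    by have := fintype.subsetP (U'_sub j s D'j _) v vU; rewrite !inE; apply.
  have := P_determined Dj sW Px Py _ vW; rewrite mulVKg !extE; apply.
  move=> t; rewrite inE => /andP[tU tW]; have [u u1 u2] := liftO j t D'j tW.
  by rewrite -u1 !extE; apply: xy; rewrite !inE u2.
have W'_neq0 j : D' j -> W' j != finset.set0.
  move=> D'j; have /fset0Pn[t tW] := W_neq0 (proj1 D'j).
  have [v _ v2] := liftO j t D'j tW.
  by apply/finset.set0Pn; exists v; rewrite inE v2.
have cardU' j s : D' j -> s \in W' j -> #|U' j s| = #|` U j.1 (j.2^-1 * val s)%g|.
  move=> D'j; rewrite inE => sW.
  rewrite cardE -(size_map (fun v : O => (j.2^-1 * val v)%g)).
  apply/perm_size/uniq_perm; rewrite ?fset_uniq ?map_inj_uniq ?enum_uniq//.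
    by move=> u v /mulgI /val_inj.
  move=> t; apply/mapP/idP => [[v]|tU]; first by rewrite mem_enum inE => ? ->.
  have tW : t \in W j.1 := fsubsetP (U_sub (proj1 D'j) sW) t tU.
  have [v _ v2] := liftO j t D'j tW.
  by exists v; rewrite // mem_enum inE v2.
have cost' s (l : seq (I * G)) : uniq l ->
    (forall j, j \in l -> D' j /\ s \in W' j) ->
    \sum_(j <- l) beta ^- (#|U' j s|.-1) <= #|B|%:R - beta.
  move=> ul lP; pose l1 := undup (map fst l).
  (* For fixed [s], the position of [s] in the window determines the translation, so [m] is
     injective and turns the sum over events into part of the double sum in [cost]. *)
  pose m (j : I * G) := (j.1, (j.2^-1 * val s)%g).
  pose f (k : I * G) := beta ^- (#|` U k.1 k.2|.-1).
  apply: le_trans (_ : \sum_(i <- l1) \sum_(t <- W i) f (i, t) <= _); last first.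
    apply: cost; first exact: undup_uniq.
    by move=> i; rewrite mem_undup => /mapP[j /lP[[Dj _] _] ->].
  rewrite -(big_allpairs_dep (h := fun (i : I) (t : G) => (i, t)) (r1 := l1)
    (r2 := fun i => W i)).
  have -> : \sum_(j <- l) beta ^- (#|U' j s|.-1) = \sum_(k <- map m l) f k.
    rewrite big_map big_seq [RHS]big_seq; apply: eq_bigr => j /lP[D'j sW].
    by rewrite /f cardU'.
  apply: ler_sum_subset.
  - by move=> k; rewrite invr_ge0 exprn_ge0// ltW.
  - rewrite map_inj_uniq// => -[i h] [i' h'] [-> /mulIg /invg_inj -> //].
  - move=> _ /mapP[j jl ->]; have [[Dj _] sW] := lP j jl.
    apply/allpairsPdep; exists j.1, (j.2^-1 * val s)%g; split => //.
      by rewrite mem_undup map_f.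
    by move: sW; rewrite inE.
pose T : {set O} := [set v : O | val v \in S]%SET.
have cardT : #|T| = #|` S|.
  rewrite cardE -(size_map val); apply/perm_size/uniq_perm.
  - by rewrite map_inj_uniq ?enum_uniq//; exact: val_inj.
  - exact: fset_uniq.
  move=> g; apply/mapP/idP => [[v]|gS]; first by rewrite mem_enum inE => ? ->.
  by exists [` fsubsetP SO g gS]%fset; rewrite // mem_enum inE.
have := card_restr_good a0 beta_gt0 bad_local mem_U' U'_sub determined cost' W'_neq0
  (finset.subsetT T).
rewrite cardT => /le_trans; apply; rewrite ler_nat.
pose tr (z : {ffun O -> A}) : {ffun S -> A} := [ffun s : S => ext z (val s)].
rewrite -(@card_in_imset _ _ tr); last first.
  move=> _ _ /imsetP[x _ ->] /imsetP[y _ ->] /ffunP eq; apply/ffunP => v.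
  have [vT|vT] := boolP (v \in T); last by rewrite !ffunE (negbTE vT).
  have vS : val v \in S by move: vT; rewrite inE.
  by have := eq [` vS]%fset; rewrite !ffunE /= !extE !ffunE.
apply/subset_leq_card/fintype.subsetP => z /imsetP[_ /imsetP[x xg ->] ->].
have /goodP[xB _ xbad] := xg.
rewrite inE; apply/asboolP; exists (ext x).
  split=> [g gO|i h Di WO Px].
    by rewrite -[g]/(val [` gO]%fset) extE xB// inE.
  have /negP : x \notin bad (i, h) by apply: xbad; rewrite ?finset.subsetT.
    by rewrite badE.
move=> s; rewrite ffunE.
have sO : val s \in O := fsubsetP SO _ (valP s).
rewrite -[val s]/(val [` sO]%fset) !extE ffunE inE /=.
by rewrite (valP s).
Qed.

(** By compactness, a pattern outside the language is already excluded on some finite set. Since [S]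
    carries finitely many patterns, one finite set [O'] detects them all, and the finite count on
    [O'] applies. *)
Lemma card_language_constrained (S : {fset G}) :
  beta ^+ #|` S| <= #|language constrained S|%:R.
Proof.
have /choice[win winP] : forall p : {ffun S -> A}, exists O : {fset G},
    (exists2 x, locally_constrained O x & {in S, forall s, s \in O ->
       x s = odflt (x s) (omap p (insub s))}) -> p \in language constrained S.
  move=> p; apply: contrapT => nO.
  have pN : p \notin language constrained S.
    by apply/negP => pL; apply: nO; exists fset0.
  (* Agreement with [p] is required only on the cells of [S] lying in [O], so that membership in
     [Y O] depends only on the restriction to [O]. The [odflt] expression is [p s] whenever [s] is
     in [S]. *)
  pose Y O : set (G -> A) := [set x | locally_constrained O x /\
    {in S, forall s, s \in O -> x s = odflt (x s) (omap p (insub s))}]%classic.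
  have [|O|x xY] := @finitary_compactness G A Y.
  - move=> O O' x y OO' [xc xS] xy; split.
      exact: locally_constrained_sub xc xy.
    move=> s sS sO; have := xS s sS (fsubsetP OO' s sO).
    by rewrite insubT /= xy.
  - apply: contrapT => nY; apply: nO; exists O => -[x xO xS].
    by exfalso; apply: nY; exists x.
  - move/negP: pN; apply; rewrite inE; apply/asboolP; exists x; last first.
      exists 1%g => s /=; rewrite mul1g.
      have [_ /(_ (val s) (valP s) (valP s))] := xY S.
      by rewrite valK.
    split=> [g|i h Di].
      by have [[xB _] _] := xY [fset g]%fset; apply: xB; rewrite inE.
    have [[_ /(_ i h Di) xP] _] := xY [fset (h * t)%g | t in W i]%fset.
    by apply: xP => t tW; rewrite in_imfset.
pose O' := (S `|` \bigcup_(p <- enum {: {ffun S -> A}}) win p)%fset.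
apply: le_trans (card_locally_constrained (fsubsetUl S _ : S `<=` O')%fset) _.
rewrite ler_nat; apply/subset_leq_card/fintype.subsetP => p; rewrite inE.
move=> /asboolP[x xO xS]; apply: winP; exists x => [|s sS sO].
  apply: locally_constrained_sub xO _ => //.
  by rewrite /O' fsubsetU// bigfcup_sup ?orbT ?mem_enum.
by rewrite insubT /= -xS.
Qed.

End GroupCounting.

(** * Subadditivity and the growth of a subshift *)

(** The limit is the infimum of the quotients: take [m] whose quotient is nearly minimal and divide
    [n] by [m] with remainder. *)
Lemma fekete (R : realType) (u : nat -> R) :
  (forall n, 0 <= u n) -> (forall m n, u (m + n)%N <= u m + u n) ->
  cvgn (fun n => u n / n%:R).
Proof.
(* The index [0] is left out, since its quotient is [0] by convention and would force the infimum to
   be [0]. *)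
move=> u0 uD; pose E : set R := [set u n / n%:R | n in [set n | 0 < n]%N]%classic.
have lE : has_lbound E.
  by exists 0 => _ [n _ <-]; rewrite divr_ge0.
have E0 : (E !=set0)%classic by exists (u 1 / 1%:R), 1%N.
apply/cvg_ex; exists (inf E); apply/cvgrPdist_lt => e e0.
have [_ [m m0 <-]] := inf_adherent (divr_gt0 e0 (ltr0n _ 2)) (conj E0 lE).
set a := u m / m%:R => a_lt.
have uM q : u (q * m)%N <= q%:R * u m + u 0%N.
  elim: q => [|q IHq]; first by rewrite mul0n mul0r add0r.
  rewrite mulSn; apply: le_trans (uD _ _) _.
  by rewrite -natr1 mulrDl mul1r; move: IHq; lra.
(* A bound, independent of [n], for the remainder term plus the [u 0] coming from [uM]; it is
   negligible after division by large [n]. *)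
pose M := \sum_(r < m) u r + u 0%N.
near=> n.
have n0 : (0 < n)%N by near: n; exact: nbhs_infty_gt.
have n0' : 0 < n%:R :> R by rewrite ltr0n.
have m0' : 0 < m%:R :> R by rewrite ltr0n.
have Mn : M / (e / 2) < n%:R by near: n; exact: nbhs_infty_gtr.
have infE : inf E <= u n / n%:R by apply: ge_inf => //; exists n.
have ur : u (n %% m)%N <= \sum_(r < m) u r.
  have r_lt : (n %% m < m)%N by rewrite ltn_pmod.
  rewrite (bigD1 (Ordinal r_lt)) //= lerDl sumr_ge0 // => i _; exact: u0.
have qm : (n %/ m)%:R * u m <= n%:R * a.
  rewrite /a mulrCA [leRHS]mulrC ler_wpM2r// ler_pdivlMr//.
  by rewrite -natrM ler_nat leq_trunc_div.
have un : u n <= n%:R * a + M.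
  rewrite {1}(divn_eq n m); apply: le_trans (uD _ _) _.
  by have := uM (n %/ m)%N; rewrite /M; move: ur qm; lra.
have : u n / n%:R < inf E + e.
  rewrite ltr_pdivrMr//; apply: le_lt_trans un _.
  move: Mn; rewrite ltr_pdivrMr ?divr_gt0// => Mn.
  have : n%:R * a <= n%:R * (inf E + e / 2) by rewrite ler_wpM2l// ltW.
  by lra.
by rewrite ltr_norml; lra.
Unshelve. all: by end_near. Qed.

Lemma exists_fset_size (T : choiceType) (n : nat) :
  (forall S : {fset T}, exists x, x \notin S) ->
  exists S : {fset T}, #|` S| = n.
Proof.
move=> Tinf; elim: n => [|n [S Sn]]; first by exists fset0; rewrite cardfs0.
by have [x xS] := Tinf S; exists (x |` S)%fset; rewrite cardfsU1 xS Sn.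
Qed.

Section Growth.
Variables (R : realType) (G : groupType) (A : finType) (X : set (G -> A)).
Hypothesis G_infinite : forall S : {fset G}, exists g, g \notin S.

Lemma complexityP n : exists2 S : {fset G}, #|` S| = n &
  complexity R X n = #|language X S|%:R.
Proof.
have [S0 S0n] := exists_fset_size n G_infinite.
pose p k := `[< exists2 S : {fset G}, #|` S| = n & #|language X S| = k >].
have exp : exists k, p k by exists #|language X S0|; apply/asboolP; exists S0.
case: (ex_minnP exp) => k /asboolP[S Sn Sk] kmin; exists S => //.
apply/le_anti/andP; split.
  apply: ge_inf; last by exists S.
  by exists 0 => _ [T _ <-].
apply: lb_le_inf; first by exists #|language X S|%:R, S.
move=> _ [T Tn <-]; rewrite ler_nat Sk; apply: kmin.
by apply/asboolP; exists T.
Qed.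

Lemma complexity_le (S : {fset G}) : complexity R X #|` S| <= #|language X S|%:R.
Proof. by apply: ge_inf; [exists 0 => _ [T _ <-]|exists S]. Qed.

(** A pattern on the union is determined by its parts on [S] and on [h * T]. The second part, read
    on [T], appears at [g * h] when the pattern appears at [g]. *)
Lemma card_language_translate (S T : {fset G}) (h : G) :
  (#|language X (S `|` [fset (h * t)%g | t in T])%fset| <=
   #|language X S| * #|language X T|)%N.
Proof.
set Z := (S `|` _)%fset.
have SZ (s : S) : val s \in Z by rewrite /Z in_fsetU (valP s).
have TZ (t : T) : (h * val t)%g \in Z.
  by rewrite /Z in_fsetU in_imfset ?orbT//=; apply: valP.
pose r1 (p : {ffun Z -> A}) : {ffun S -> A} := [ffun s => p [` SZ s]%fset].
pose r2 (p : {ffun Z -> A}) : {ffun T -> A} := [ffun t => p [` TZ t]%fset].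
rewrite -cardsX -(@card_in_imset _ _ (fun p => (r1 p, r2 p))); last first.
  move=> p q _ _ [/ffunP pq1 /ffunP pq2]; apply/ffunP => z.
  have := valP z; rewrite {1}/Z in_fsetU => /orP[zS|/imfsetP[t /= tT zt]].
    have := pq1 [` zS]%fset; rewrite !ffunE.
    by congr (p _ = q _); exact: val_inj.
  have := pq2 [` tT]%fset; rewrite !ffunE.
  by congr (p _ = q _); exact: val_inj.
apply/subset_leq_card/fintype.subsetP => z /imsetP[p pL ->]; move: pL.
rewrite inE => /asboolP[x xX [g xp]].
rewrite finset.in_setX; apply/andP; split; rewrite inE; apply/asboolP.
  exists x => //; exists g => s; rewrite ffunE.
  exact: xp [` SZ s]%fset.
exists x => //; exists (g * h)%g => t; rewrite ffunE -mulgA.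
exact: xp [` TZ t]%fset.
Qed.

Lemma fset_disjoint_translate (S T : {fset G}) :
  exists h, [disjoint S & [fset (h * t)%g | t in T]]%fset.
Proof.
have [h hP] := G_infinite [fset (s * t^-1)%g | s in S, t in T]%fset.
exists h; apply/fdisjointP => s sS; apply: contra hP => /imfsetP[t /= tT sE].
by apply/imfset2P; exists s => //=; exists t => //; rewrite sE mulgK.
Qed.

Lemma complexityD m n :
  complexity R X (m + n) <= complexity R X m * complexity R X n.
Proof.
have [S <- ->] := complexityP m; have [T <- ->] := complexityP n.
have [h dis] := fset_disjoint_translate S T.
have -> : (#|` S| + #|` T| = #|` S `|` [fset (h * t)%g | t in T]|)%N%fset.
  rewrite cardfsU (eqP dis) cardfs0 subn0 card_imfset//; exact: mulgI.
apply: le_trans (complexity_le _) _.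
by rewrite -natrM ler_nat card_language_translate.
Qed.

(** The bound passes to [lim] only once convergence is known. Convergence follows from Fekete's
    lemma for the logarithm of the complexity, which is nonnegative because [1 <= beta]. *)
Lemma growth_ge (beta : R) : 1 <= beta ->
  (forall S : {fset G}, beta ^+ #|` S| <= #|language X S|%:R) ->
  beta <= growth R X.
Proof.
move=> beta1 lang; have beta0 : 0 < beta by apply: lt_le_trans beta1.
have cge n : beta ^+ n <= complexity R X n.
  by have [S <- ->] := complexityP n.
have c1 n : 1 <= complexity R X n by apply: le_trans (cge n); rewrite exprn_ege1.
have c0 n : 0 < complexity R X n by apply: lt_le_trans (c1 n).
have cvg_u : cvgn (fun n => ln (complexity R X n) / n%:R).
  apply: fekete => [n|m n]; first exact: ln_ge0.
  by rewrite -lnM ?posrE// ler_ln ?posrE ?mulr_gt0// complexityD.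
have powE n : complexity R X n `^ n%:R^-1 = expR (ln (complexity R X n) / n%:R).
  by rewrite /powR gt_eqF// mulrC.
have cvg_c : cvgn (fun n => complexity R X n `^ n%:R^-1).
  under eq_fun do rewrite powE.
  apply: cvgP; apply: continuous_cvg; last exact: cvg_u.
  exact: continuous_expR.
apply: limr_ge => //; near=> n.
have n0 : (0 < n)%N by near: n; exact: nbhs_infty_gt.
have -> : beta = (beta ^+ n) `^ n%:R^-1.
  by rewrite -powR_mulrn ?ltW// -powRrM mulfV ?pnatr_eq0 -?lt0n// powRr1// ltW.
by apply: ge0_ler_powR; rewrite ?invr_ge0 ?nnegrE ?exprn_ge0 ?(ltW beta0) ?(ltW (c0 _)).
Unshelve. all: by end_near. Qed.

End Growth.

(** * Elementary estimates for the cost of periods *)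

Lemma bernoulli_ineq (R : realDomainType) (d : R) n :
  0 <= d -> 1 + n%:R * d <= (1 + d) ^+ n.
Proof.
move=> d0; elim: n => [|n IHn]; first by rewrite mul0r addr0.
rewrite exprS; apply: le_trans (ler_wpM2l _ IHn); last by rewrite addr_ge0.
rewrite -natr1; have : 0 <= n%:R * d * d by rewrite !mulr_ge0.
by lra.
Qed.

(** Take [k = 2j + 1] and [d = beta - 1]. Bernoulli squared gives [beta ^+ 2j >= (j d) ^+ 2],
    quadratic in [j], while [2k = 4j + 2 <= 6j]; hence the constant [6]. *)
Lemma exists_linear_le_geometric (R : archiRealFieldType) (beta e : R) :
  1 < beta -> 0 < e -> exists2 k, (0 < k)%N & k.*2%:R * beta ^- k.-1 <= e.
Proof.
move=> beta1 e0; pose d := beta - 1; have d0 : 0 < d by rewrite subr_gt0.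
have beta0 : 0 < beta by lra.
have [j jn0 jbig] : exists2 j, (0 < j)%N & 6 / (e * d ^+ 2) <= j%:R.
  exists (Num.bound (6 / (e * d ^+ 2))).+1 => //.
  apply: le_trans (_ : (Num.bound (6 / (e * d ^+ 2)))%:R <= _).
    by apply/ltW/archi_boundP; rewrite divr_ge0 ?mulr_ge0 ?exprn_ge0 ?ltW.
  by rewrite ler_nat.
have j0 : 0 < j%:R :> R by rewrite ltr0n.
exists j.*2.+1 => //; rewrite [j.*2.+1.-1]/=.
have jlarge : 6 <= e * (j%:R * d ^+ 2).
  by rewrite mulrCA -ler_pdivrMr ?mulr_gt0 ?exprn_gt0.
have beta_j : (j%:R * d) ^+ 2 <= beta ^+ j.*2.
  rewrite -muln2 exprM ler_pXn2r ?nnegrE ?mulr_ge0 ?exprn_ge0 ?(ltW d0) ?(ltW beta0)//.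
  have := bernoulli_ineq j (ltW d0); rewrite {2}/d subrKC; lra.
rewrite ler_pdivrMr ?exprn_gt0//.
apply: le_trans (_ : e * (j%:R * d) ^+ 2 <= _); last by rewrite ler_pM2l.
rewrite exprMn expr2 mulrCA -mulrA mulrCA.
apply: le_trans (_ : j%:R * 6 <= _); last first.
  by rewrite ler_pM2l// mulrCA.
rewrite -natrM ler_nat -!muln2; lia.
Qed.

(** These weights share a total budget among countably many periods, [n] being the code of a group
    element. *)
Lemma sum_half_le1 (R : realFieldType) (l : seq nat) : uniq l ->
  \sum_(n <- l) (2^-1 : R) ^+ n.+1 <= 1.
Proof.
move=> ul; pose N := (\max_(n <- l) n).+1.
apply: le_trans (_ : \sum_(n <- iota 0 N) (2^-1 : R) ^+ n.+1 <= _).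
  apply: ler_sum_subset => // n nl.
  by rewrite mem_iota /= add0n ltnS; apply: leq_bigmax_seq.
have -> M : \sum_(n <- iota 0 M) (2^-1 : R) ^+ n.+1 = 1 - 2^-1 ^+ M.
  elim: M => [|M IHM]; first by rewrite big_nil subrr.
  by rewrite -addn1 iotaD big_cat /= big_seq1 IHM add0n addn1 exprS; lra.
by rewrite gerBl exprn_ge0.
Qed.

(** * Removing one-cell patterns and passing to a base above 1 *)

Section Free.
Variables (R : realType) (G : groupType) (A : finType) (F : set (pattern G A)).

Definition free_letters : {set A} := [set a | `[< free_letter F a >]]%SET.

Lemma psize1_eq (f : pattern G A) (s t : domf (val f)) :
  psize f = 1%N -> s = t.
Proof.
move=> /eqP/cardfs1P[g fg]; apply: val_inj.
have mem_g u : u \in domf (val f) -> u = g by rewrite fg inE => /eqP.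
by rewrite (mem_g _ (valP s)) (mem_g _ (valP t)).
Qed.

(** Each non-free letter is the value of some one-cell pattern of [F], and a one-cell pattern has a
    single value, so distinct letters get distinct patterns. *)
Lemma nonfree_patterns (s : seq A) : uniq s ->
  {in s, forall a, a \notin free_letters} ->
  exists l : seq (pattern G A), [/\ uniq l, size l = size s &
    {in l, forall f, [/\ F f, psize f = 1%N &
       exists t : domf (val f), val f t \in s]}].
Proof.
elim: s => [|a s IHs] /=; first by exists [::].
move=> /andP[as_ us] ns; have [b bs|l [ul sl lF]] := IHs us.
  by apply: ns; rewrite inE bs orbT.
have [f [Ff f1 [t ta]]] : exists f, [/\ F f, psize f = 1%N &
    exists t : domf (val f), val f t = a].
  apply: contrapT => nf; have := ns a (mem_head _ _); rewrite inE => /asboolP; apply.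
  move=> f Ff f1 t; apply/eqP => ta; apply: nf; exists f; split => //.
  by exists t.
exists (f :: l); split => /=; rewrite ?sl// ?ul ?andbT.
  apply/negP => /lF[_ _ [t' t's]]; move: as_.
  by rewrite -ta (psize1_eq t t' f1) t's.
move=> g; rewrite inE => /orP[/eqP->|/lF[Fg g1 [t' t's]]]; split => //.
  by exists t; rewrite ta mem_head.
by exists t'; rewrite inE t's orbT.
Qed.

Lemma psize_gt0 (f : pattern G A) : (0 < psize f)%N.
Proof. by rewrite cardfs_gt0; exact: (valP f). Qed.

Lemma exprz_psize (beta : R) (f : pattern G A) :
  beta ^ (1 - (psize f)%:Z) = beta ^- (psize f).-1.
Proof.
rewrite -{1}(prednK (psize_gt0 f)) exprnN; congr (_ ^ _).
by rewrite -addn1 PoszD opprD addrCA subrr addr0.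
Qed.

(** Strictness of the hypothesis leaves a slack [d] common to all finite partial sums. An infinite
    sum would contradict the hypothesis. *)
Lemma sum_patterns_le (beta : R) : 0 < beta ->
  (beta%:E < #|A|%:R%:E -
     \esum_(f in F) ((psize f)%:R * beta ^ (1 - (psize f)%:Z))%:E)%E ->
  exists2 d, 0 < d & forall l : seq (pattern G A), uniq l ->
    (forall f, f \in l -> F f) ->
    \sum_(f <- l) (psize f)%:R * beta ^- (psize f).-1 <= #|A|%:R - beta - d.
Proof.
move=> beta0; set E := (\esum_(_ in _) _)%E.
have le_E l : uniq l -> (forall f, f \in l -> F f) ->
    ((\sum_(f <- l) (psize f)%:R * beta ^- (psize f).-1)%:E <= E)%E.
  move=> ul lF; apply: esum_ge; exists [set` l]%classic.
    by split=> [|f /lF//]; exact: finite_seq.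
  rewrite -fsbig_seq// sumEFin lee_fin.
  by under [leRHS]eq_bigr do rewrite exprz_psize.
move: E le_E => [r| |] le_E //=; last first.
  by have := le_E [::] isT (fun _ => ltac:(done)); rewrite leeNy_eq.
rewrite -EFinB lte_fin => ltr; exists (#|A|%:R - r - beta); first by lra.
by move=> l ul /(le_E l ul); rewrite lee_fin; lra.
Qed.

(* For [beta <= 1] the slack left by two free letters allows passing to some
   [beta' > 1], since terms with [1 < psize f] shrink at least by the factor
   [beta / beta']. *)
Lemma reduce_to_free_letters (beta : R) : 0 < beta ->
  (beta%:E < #|A|%:R%:E -
     \esum_(f in F) ((psize f)%:R * beta ^ (1 - (psize f)%:Z))%:E)%E ->
  (beta < 1 -> two_free_letters F) ->
  exists beta' e : R, [/\ 1 < beta', beta <= beta', 0 < e &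
    forall l : seq (pattern G A), uniq l ->
      (forall f, f \in l -> F f /\ (1 < psize f)%N) ->
      \sum_(f <- l) (psize f)%:R * beta' ^- (psize f).-1 <=
        #|free_letters|%:R - beta' - e].
Proof.
move=> beta0 /(sum_patterns_le beta0)[d d0 sumF] degenerate.
set B := free_letters.
have sumB l : uniq l -> (forall f, f \in l -> F f /\ (1 < psize f)%N) ->
    \sum_(f <- l) (psize f)%:R * beta ^- (psize f).-1 <= #|B|%:R - beta - d.
  move=> ul lF; have [|l1 [ul1 sl1 l1F]] := @nonfree_patterns (enum (~: B)) (enum_uniq _).
    by move=> a; rewrite mem_enum inE.
  have := sumF (l1 ++ l); rewrite big_cat /=.
  (* A one-cell pattern costs exactly [1], so these patterns pay for replacing [A] by [B]. *)
  have -> : \sum_(f <- l1) (psize f)%:R * beta ^- (psize f).-1 = #|A|%:R - #|B|%:R.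
    rewrite big_seq (eq_bigr (fun=> 1)) => [|f /l1F[_ -> _]]; last first.
      by rewrite mul1r expr0 invr1.
    rewrite -big_seq big_const_seq iter_addr_0 count_predT sl1 -cardE.
    by rewrite cardsCs finset.setCK natrB ?max_card.
  suff Fl1l : uniq (l1 ++ l) /\ forall f, f \in l1 ++ l -> F f.
    by move=> /(_ Fl1l.1 Fl1l.2); lra.
  split; last by move=> f; rewrite mem_cat => /orP[/l1F[]|/lF[]].
  rewrite cat_uniq ul1 ul andbT /=; apply/hasPn => f /lF[_ f1].
  by apply/negP => /l1F[_ f1' _]; rewrite f1' in f1.
have [beta1|beta1] := ltP 1 beta; first by exists beta, d.
have B2 : 2 <= #|B|%:R :> R.
  (* If [beta = 1], the slack gives [#|B| > 1]; if [beta < 1], two free letters are given. *)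
  rewrite (ler_nat R 2); move: beta1; rewrite le_eqVlt => /orP[/eqP b1|/degenerate].
    have := sumB [::] isT (fun _ => ltac:(done)); rewrite big_nil b1.
    by rewrite -(ltr_nat R 1); lra.
  move=> [a [b [ab fa fb]]]; rewrite (cardsD1 a) (cardsD1 b) !inE eq_sym ab /=.
  by rewrite !asboolT.
(* With [beta' = 1 + e], the two occurrences of [e] in the goal add up to [beta * d]. What remains
   is [(1 - beta) * (#|B| - 1 - beta) >= 0], true as [#|B| >= 2]. *)
pose e := beta * d / 2; have e0 : 0 < e by rewrite divr_gt0 ?mulr_gt0.
exists (1 + e), e; split => //; [lra..|].
move=> l ul lF; apply: le_trans (_ : beta * (#|B|%:R - beta - d) <= _); last first.
  rewrite /e; have : 0 <= (1 - beta) * (#|B|%:R - 1 - beta) by rewrite mulr_ge0//; lra.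
  by lra.
apply: le_trans (ler_wpM2l (ltW beta0) (sumB l ul lF)).
rewrite mulr_sumr big_seq [leRHS]big_seq; apply: ler_sum => f /lF[_ f1].
rewrite mulrCA ler_wpM2l//.
case: (psize f) f1 => [|[|n]] //= _.
rewrite exprSr invfM [beta ^+ n.+1]exprSr invfM mulrCA mulfV ?gt_eqF// mulr1.
apply: le_trans (_ : (1 + e) ^- n <= _).
  rewrite ler_piMr ?invr_ge0 ?exprn_ge0 ?invf_le1//; lra.
by rewrite lef_pV2 ?posrE ?exprn_gt0//; [apply: lerXn2r; rewrite ?nnegrE; lra|lra].
Qed.

End Free.

Lemma exists_notin_fset (T : choiceType) (S : {fset T}) :
  ([set: T] #= [set: nat])%card -> exists x, x \notin S.
Proof.
move=> Tnat; apply: contrapT => nx.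
have : finite_set [set: T].
  apply: sub_finite_set (finite_fset S) => x _ /=.
  by apply: contrapT => /negP xS; apply: nx; exists x.
by rewrite (eq_finite_set Tnat) => /infinite_nat.
Qed.

(** * Finite sets disjoint from a translate *)

Section Periods.
Variables (G : groupType).
Hypothesis G_infinite : forall S : {fset G}, exists g, g \notin S.

Definition translate (g : G) (T : {fset G}) : {fset G} :=
  [fset (g * t)%g | t in T]%fset.

Lemma in_translate g T t : (t \in translate g T) = ((g^-1 * t)%g \in T).
Proof.
apply/imfsetP/idP => [[u /= uT ->]|tT]; first by rewrite mulKg.
by exists (g^-1 * t)%g; rewrite ?mulVKg.
Qed.

Lemma card_translate g T : #|` translate g T| = #|` T|.
Proof. by rewrite card_imfset//; apply: mulgI. Qed.

(** [T] grows one cell at a time: the new cell [t] avoids [T], [g T] and [g^-1 T], and differs from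
    [g t] because [g] is not [1]. *)
Lemma exists_disjoint_translate (g : G) (k : nat) : g != 1%g ->
  exists2 T : {fset G}, #|` T| = k & [disjoint T & translate g T]%fset.
Proof.
move=> g1; elim: k => [|k [T Tk dis]].
  by exists fset0; rewrite ?cardfs0 ?fdisjoint0X.
have [t] := G_infinite (T `|` (translate g T `|` translate g^-1 T))%fset.
rewrite !in_fsetU !negb_or !in_translate invgK => /and3P[tT tgT tg'T].
exists (t |` T)%fset; first by rewrite cardfsU1 tT Tk.
apply/fdisjointP => u; rewrite in_translate !in_fset1U negb_or.
move=> /orP[/eqP->|uT].
  rewrite tgT andbT -(inj_eq (@mulgI _ g)) mulVKg eq_sym.
  by rewrite -{2}[t]mul1g (inj_eq (@mulIg _ t)).
have := fdisjointP dis u uT; rewrite in_translate => ->; rewrite andbT.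
by apply: contraNneq tg'T => <-; rewrite mulVKg.
Qed.

End Periods.

Lemma big_seq_sum (R : nmodType) (I J : Type) (F : I + J -> R) (l : seq (I + J)) :
  \sum_(i <- l) F i =
    \sum_(i <- pmap (fun i => if i is inl a then Some a else None) l) F (inl i) +
    \sum_(j <- pmap (fun i => if i is inr b then Some b else None) l) F (inr j).
Proof.
elim: l => [|[a|b] l IHl]; rewrite ?big_nil ?addr0//= !big_cons IHl.
  by rewrite addrA.
by rewrite addrCA.
Qed.

(** * The subshift forbidding both the patterns of [F] and the periods *)

Section Assembly.
Variables (R : realType) (G : groupType) (A : finType) (F : set (pattern G A)).
Variables (k : G -> nat) (T : G -> {fset G}).
Hypothesis k_gt0 : forall g, (0 < k g)%N.
Hypothesis cardT : forall g, g != 1%g -> #|` T g| = k g.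
Hypothesis disjointT : forall g, g != 1%g -> [disjoint T g & translate g (T g)]%fset.

Let W (i : pattern G A + G) : {fset G} :=
  match i with
  | inl f => domf (val f)
  | inr g => (T g `|` translate g (T g))%fset
  end.

Let P (i : pattern G A + G) (x : G -> A) : Prop :=
  match i with
  | inl f => forall s : domf (val f), x (val s) = val f s
  | inr g => {in T g, forall t, x t = x (g * t)%g}
  end.

(** A forbidden pattern prescribes its whole support, so all of it is erased. For a period, the half
    containing [t] is erased, being a copy of the other half. *)
Let U (i : pattern G A + G) (t : G) : {fset G} :=
  match i with
  | inl f => domf (val f)
  | inr g => if t \in T g then T g else translate g (T g)
  end.

(** One-cell patterns are not events: restricting the letters to [B] already excludes them. *)
Let D (i : pattern G A + G) : Prop :=
  match i with
  | inl f => F f /\ (1 < psize f)%N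
  | inr g => g != 1%g
  end.

Let B := free_letters F.
Let X := constrained D P B.

Let W_neq0 i : D i -> W i != fset0.
Proof.
case: i => [f|g] /= Di; first exact: (valP f).
rewrite -cardfs_gt0; apply: leq_trans (fsubset_leq_card (fsubsetUl _ _)).
by rewrite cardT.
Qed.

Let P_local i (x y : G -> A) : D i -> {in W i, x =1 y} -> P i x -> P i y.
Proof.
case: i => [f|g] /= _ xy xP; first by move=> s; rewrite -xP xy//; exact: valP.
move=> t tT; have gtT : (g * t)%g \in translate g (T g).
  by rewrite in_translate mulKg.
by rewrite -(xy t) ?in_fsetU ?tT// -(xy (g * t)%g) ?in_fsetU ?gtT ?orbT// xP.
Qed.

Let mem_U i t : D i -> t \in W i -> t \in U i t.
Proof.
by case: i => [f|g] //= _; rewrite in_fsetU; case: ifP => //= ->.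
Qed.

Let U_sub i t : D i -> t \in W i -> (U i t `<=` W i)%fset.
Proof.
case: i => [f|g] //= _ _; case: ifP => _; [exact: fsubsetUl|exact: fsubsetUr].
Qed.

Let P_determined i t (x y : G -> A) : D i -> t \in W i -> P i x -> P i y ->
  {in (W i `\` U i t)%fset, x =1 y} -> {in W i, x =1 y}.
Proof.
case: i => [f|g] /= Di _ xP yP xy u; rewrite ?in_fsetU.
  by move=> uf; rewrite -[u]/(val [` uf]%fset) xP yP.
have dis := fdisjointP (disjointT Di).
(* The half that is not erased carries the agreement of [x] and [y]; the equality of halves then
   transfers it to the other. *)
have key : {in T g, x =1 y} \/ {in T g, forall v, x (g * v)%g = y (g * v)%g}.
  case: ifP xy => _ xy; [right|left] => v vT; apply: xy.
    rewrite in_fsetD in_fsetU in_translate mulKg vT orbT andbT.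
    by apply: contraTN vT => /dis; rewrite in_translate mulKg.
  by rewrite in_fsetD in_fsetU vT dis.
have eqT : {in T g, x =1 y}.
  by case: key => // key v vT; rewrite xP// yP// key.
move=> /orP[/eqT//|]; rewrite in_translate => vT.
by rewrite -[u](mulVKg g) -xP// -yP// eqT.
Qed.

(** The event of the period [g] is expressed by forbidding every pattern on its window that forces
    it; this exhibits [X] as a subshift. *)
Let period_pattern (f : pattern G A) : Prop := exists g, [/\ g != 1%g,
  domf (val f) = W (inr g) & forall x, (forall s : domf (val f),
    x (val s) = val f s) -> P (inr g) x].

Let X_avoids : X = [set x | avoids (F `|` period_pattern) x]%classic.
Proof.
apply/seteqP; split => x /=.
  move=> [xB xP] f [Ff [h hf]|[g [g1 _ fP]] [h hf]]; last first.
    exact: (xP (inr g) h g1 (fP (fun t => x (h * t)%g) hf)).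
  have := psize_gt0 f; rewrite leq_eqVlt => /orP[/eqP f1|f1].
    have /fset0Pn[s sf] : domf (val f) != fset0 by exact: (valP f).
    have := xB (h * s)%g; rewrite inE => /asboolP /(_ f Ff (esym f1) [` sf]%fset).
    by rewrite -hf eqxx.
  exact: (xP (inl f) h).
move=> xF; split=> [g|[f|g] h /= Di].
- rewrite inE; apply/asboolP => f Ff f1 s; apply/eqP => fs.
  apply: (xF f (or_introl Ff)); exists (g * (val s)^-1)%g => t.
  by rewrite (psize1_eq t s f1) mulgVK fs.
- by move=> xf; case: Di => Ff _; apply: (xF f (or_introl Ff)); exists h.
- move=> xg; pose p : {fmap G -> A} :=
    FinMap [ffun s : W (inr g) => x (h * val s)%g].
  have pE (s : domf p) : p s = x (h * val s)%g by rewrite ffunE.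
  have p0 : domf p != fset0 := @W_neq0 (inr g) Di.
  apply: (xF (exist _ p p0)); last by exists h => s; rewrite pE.
  right; exists g; split => // y yp.
  apply: (@P_local (inr g) (fun t => x (h * t)%g) y Di _ xg) => t tW.
  by have /= <- := pE [` tW]%fset; rewrite -(yp [` tW]%fset).
Qed.

Lemma constrained_strongly_aperiodic : strongly_aperiodic_subshift X.
Proof.
split; first by exists (F `|` period_pattern)%classic; exact: X_avoids.
move=> x [_ xP] g xg; apply/eqP; apply: contrapT => /negP g1.
by apply: (xP (inr g) 1%g g1) => t _; rewrite !mul1g.
Qed.

Variables (beta e : R) (num : G -> nat).
Hypothesis beta_gt1 : 1 < beta.
Hypothesis e_gt0 : 0 < e.
Hypothesis num_inj : injective num.
Hypothesis cost_period : forall g,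
  (k g).*2%:R * beta ^- (k g).-1 <= e * 2^-1 ^+ (num g).+1.
Hypothesis cost_F : forall l : seq (pattern G A), uniq l ->
  (forall f, f \in l -> F f /\ (1 < psize f)%N) ->
  \sum_(f <- l) (psize f)%:R * beta ^- (psize f).-1 <= #|B|%:R - beta - e.

(** The patterns leave a reserve [e]. The period [g] costs [2 k g] positions times
    [beta ^- (k g).-1], and these costs together use at most [e]. *)
Let cost l : uniq l -> (forall i, i \in l -> D i) ->
  \sum_(i <- l) \sum_(t <- W i) beta ^- (#|` U i t|.-1) <= #|B|%:R - beta.
Proof.
move=> ul lD; rewrite big_seq_sum.
set l1 := pmap _ l; set l2 := pmap _ l.
have ul1 : uniq l1 by apply: (pmap_uniq (g := inl)) ul => -[].
have ul2 : uniq l2 by apply: (pmap_uniq (g := inr)) ul => -[].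
have l1D f : f \in l1 -> F f /\ (1 < psize f)%N.
  by rewrite mem_pmap => /mapP[[f'|//] /lD Df [->]].
have l2D g : g \in l2 -> g != 1%g.
  by rewrite mem_pmap => /mapP[[//|g'] /lD Dg [->]].
have -> : \sum_(f <- l1) \sum_(t <- W (inl f)) beta ^- (#|` U (inl f) t|.-1) =
    \sum_(f <- l1) (psize f)%:R * beta ^- (psize f).-1.
  apply: eq_bigr => f _ /=.
  by rewrite big_const_seq iter_addr_0 count_predT mulr_natl.
suff : \sum_(g <- l2) \sum_(t <- W (inr g)) beta ^- (#|` U (inr g) t|.-1) <= e.
  by have := cost_F ul1 l1D; lra.
apply: le_trans (_ : \sum_(g <- l2) e * 2^-1 ^+ (num g).+1 <= _); last first.
  rewrite -mulr_sumr ler_piMr ?(ltW e_gt0)//.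
  have := @sum_half_le1 R (map num l2); rewrite big_map map_inj_uniq//; exact.
rewrite big_seq [leRHS]big_seq; apply: ler_sum => g /l2D g1.
apply: le_trans (cost_period g).
rewrite (eq_bigr (fun=> beta ^- (k g).-1)) => [|t _ /=]; last first.
  by case: ifP; rewrite ?card_translate cardT.
rewrite big_const_seq iter_addr_0 count_predT mulr_natl.
suff -> : size (W (inr g)) = (k g).*2 by [].
change (#|` W (inr g)| = (k g).*2); rewrite /= cardfsU (eqP (disjointT g1)) cardfs0 subn0.
by rewrite card_translate cardT// addnn.
Qed.

Lemma card_language_aperiodic (S : {fset G}) :
  beta ^+ #|` S| <= #|language X S|%:R.
Proof.
apply: (card_language_constrained _ P_local mem_U U_sub P_determined W_neq0 cost).
exact: lt_trans beta_gt1.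
Qed.

Lemma exists_strongly_aperiodic_subshift : exists X : set (G -> A),
  [/\ strongly_aperiodic_subshift X, (X !=set0)%classic,
      forall x, X x -> avoids F x &
      forall S : {fset G}, beta ^+ #|` S| <= #|language X S|%:R].
Proof.
exists X; split; [exact: constrained_strongly_aperiodic| | |
  exact: card_language_aperiodic].
  (* On the empty support the bound reads [1 <= #|language X fset0|], which produces a
     configuration. *)
  have : (0 < #|language X fset0|)%N.
    rewrite -(ltr_nat R); apply: lt_le_trans (card_language_aperiodic fset0).
    by rewrite exprn_gt0// (lt_trans _ beta_gt1).
  by move=> /card_gt0P[p]; rewrite inE => /asboolP[x xX _]; exists x.
by rewrite X_avoids => x xF f Ff; apply: xF; left.
Qed.

End Assembly.

(** * Choice of the parameters and conclusion *)

Local Open Scope classical_set_scope.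

Theorem theorem13 (R : realType) (G : groupType) (A : finType)
  (G_countably_infinite : ([set: G] #= [set: nat])%card)
  (F : set (pattern G A)) (beta : R)
  (beta_gt0 : 0 < beta)
  (hbeta : (beta%:E < #|A|%:R%:E -
     \esum_(f in F) ((psize f)%:R * beta ^ (1 - (psize f)%:Z))%:E)%E)
  (hdegenerate : beta < 1 -> two_free_letters F) :
  (exists X : set (G -> A),
     [/\ strongly_aperiodic_subshift X, X !=set0
       & forall x, X x -> avoids F x])
  /\
  (amenable R G ->
   exists X : set (G -> A),
     [/\ strongly_aperiodic_subshift X, X !=set0,
         forall x, X x -> avoids F x
       & beta <= growth R X]).
Proof.
have G_infinite S : exists g : G, g \notin S := exists_notin_fset S G_countably_infinite.
have [num num_inj] : exists num : G -> nat, injective num.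
  have /countable_injP[num numP] : countable [set: G].
    by move: G_countably_infinite; rewrite card_eq_le => /andP[].
  by exists num => g h; apply: numP; rewrite inE.
have [beta' [e [beta1 betale e0 cost]]] :=
  reduce_to_free_letters beta_gt0 hbeta hdegenerate.
(* The size of [T g] is chosen so large that the period [g] costs at most its share of [e], weighted
   by the code [num g]. *)
have /choice[k kP] g : exists k, (0 < k)%N /\
    k.*2%:R * beta' ^- k.-1 <= e * 2^-1 ^+ (num g).+1.
  have [|k k0 kle] := exists_linear_le_geometric beta1 (_ : 0 < e * 2^-1 ^+ (num g).+1).
    by rewrite mulr_gt0 ?exprn_gt0.
  by exists k.
have /choice[T TP] g : exists T : {fset G}, g != 1%g ->
    #|` T| = k g /\ [disjoint T & translate g T]%fset.
  have [->|g1] := eqVneq g 1%g; first by exists fset0.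
  by have [T ? ?] := exists_disjoint_translate G_infinite (k g) g1; exists T.
have [X [X_aper X_neq0 XF langX]] := exists_strongly_aperiodic_subshift
  (fun g => (kP g).1) (fun g g1 => (TP g g1).1) (fun g g1 => (TP g g1).2)
  beta1 e0 num_inj (fun g => (kP g).2) cost.
split; first by exists X.
move=> _; exists X; split=> //; apply: le_trans betale _.
by apply: growth_ge; rewrite ?ltW.
Qed.
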